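(* For each of the following three conditions: (i) $\lambda_1(F,\Omega)>0$, (ii) $\lambda_*(F,\Omega)>0$, (iii) $\overline\lambda_1(F,\Omega)>0$, there exist a bounded domain $\Omega\subset\mathbb{R}^N$ (for some $N\geq 1$), an open set $\mathcal{O}\supset\overline\Omega$, and a degenerate elliptic linear operator $$F[u]=-\mathrm{Tr}(A(x)D^2u)-b(x)\cdot Du-c(x)u,\qquad A(x)\ge0,$$ with coefficients continuous in $\mathcal{O}$ and smooth in $\Omega$, which does not satisfy the Maximum Principle property MP in $\Omega$ and yet satisfies that condition. Moreover, for cases (i) and (ii), such an operator can be taken to satisfy the following structure condition: for all $R>0$ there exists a function $\omega\in C([0,+\infty))$ with $\omega(0)=0$ such that, if $X,Y\in\mathcal{S}_N$ and $\sigma>0$ satisfy $$-3\sigma\begin{pmatrix} I&0\\0&I\end{pmatrix}\le\begin{pmatrix}X&0\\0&-Y\end{pmatrix}\le3\sigma\begin{pmatrix}I&-I\\-I&I\end{pmatrix},$$ then $F(y,r,\sigma(x-y),Y)-F(x,r,\sigma(x-y),X)\le\omega(\sigma|x-y|^2+|x-y|)$ for all $x,y\in\mathcal{O}$ and $|r|\le R$.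
   Context: Notation: $\mathcal{S}_N$ is the space of $N\times N$ real symmetric matrices with its usual partial order, $I$ is the identity matrix; $USC(E)$ and $LSC(E)$ are the sets of upper and lower semicontinuous functions on $E$. For a linear operator as in the claim, write $F(x,r,p,X)=-\mathrm{Tr}(A(x)X)-b(x)\cdot p-c(x)r$ and $F[u](x)=F(x,u(x),Du(x),D^2u(x))$; degenerate elliptic means $A(x)$ is symmetric nonnegative definite (possibly zero) for every $x$. Property MP: $F$ satisfies MP in $\Omega$ if every viscosity subsolution $u\in USC(\overline\Omega)$ of the Dirichlet problem $F[u]=0$ in $\Omega$, $u=0$ on $\partial\Omega$, satisfies $u\le0$ in $\overline\Omega$. Here $u\in USC(\overline\Omega)$ is a viscosity subsolution if for all $\varphi\in C^2(\overline\Omega)$ and $\xi\in\overline\Omega$ such that $(u-\varphi)(\xi)=\max_{\overline\Omega}(u-\varphi)$ one has $$F(\xi,u(\xi),D\varphi(\xi),D^2\varphi(\xi))\le0\ \text{ if }\xi\in\Omega,\qquad \max\big[u(\xi),\,F(\xi,u(\xi),D\varphi(\xi),D^2\varphi(\xi))\big]\le0\ \text{ if }\xi\in\partial\Omega.$$ Notions of generalized principal eigenvalue (suprema in $[-\infty,+\infty]$; inequalities $F[\phi]-\lambda\phi\ge0$ in $\Omega$ are in the viscosity sense, i.e. $F(x_0,\phi(x_0),D\psi(x_0),D^2\psi(x_0))-\lambda\phi(x_0)\ge0$ whenever $\psi$ is $C^2$ and $\phi-\psi$ has a local minimum at $x_0\in\Omega$): $$\lambda_1(F,\Omega):=\sup\{\lambda\in\mathbb{R}:\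 \exists\phi\in LSC(\Omega),\ \phi>0\text{ and }F[\phi]-\lambda\phi\ge0\text{ in }\Omega\},$$ $$\overline\lambda_1(F,\Omega):=\sup\{\lambda\in\mathbb{R}:\ \exists\phi\in LSC(\Omega),\ \inf_\Omega\phi>0,\ F[\phi]-\lambda\phi\ge0\text{ in }\Omega\},$$ $$\lambda_*(F,\Omega):=\liminf_{\varepsilon\to0^+}\lambda^\varepsilon,$$ where $\lambda^\varepsilon$ is the classical Dirichlet principal eigenvalue of the regularized operator $-\varepsilon\Delta+F$ in $\Omega$. *)

(* Defs.v *)
From mathcomp Require Import all_boot all_order all_algebra.
From mathcomp Require Import all_classical all_reals all_analysis.

Set Implicit Arguments.
Unset Strict Implicit.
Unset Printing Implicit Defensive.

Import Order.TTheory GRing.Theory Num.Theory.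
Import numFieldNormedType.Exports.

Local Open Scope classical_set_scope.
Local Open Scope ring_scope.

Section Definitions.
Context {R : realType} {N : nat}.
Implicit Types (Om O E : set 'rV[R]_N) (x y p : 'rV[R]_N).

Definition dotrv x y : R := (x *m y^T) 0 0.

(* The norm `|x| of the library on row vectors is the sup norm. *)
Definition enorm x : R := Num.sqrt (dotrv x x).

Definition boundary E : set 'rV[R]_N := closure E `\` E°.

Definition bounded_domain Om : Prop :=
  [/\ Om !=set0, open Om, connected Om & bounded_set Om].

Definition grad (f : 'rV[R]_N -> R) x : 'rV[R]_N :=
  \row_i 'D_(delta_mx 0 i) f x.

Definition hess (f : 'rV[R]_N -> R) x : 'M[R]_N :=
  \matrix_(i, j) 'D_(delta_mx 0 i) ('D_(delta_mx 0 j) f) x.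

(* f is of class C^k on the set E, which is meant to be open. *)
Fixpoint class_C (k : nat) E (f : 'rV[R]_N -> R) : Prop :=
  (forall x, E x -> {for x, continuous f}) /\
  (if k is k'.+1 then
     forall i : 'I_N, (forall x, E x -> derivable f x (delta_mx 0 i)) /\
                      class_C k' E ('D_(delta_mx 0 i) f)
   else True).

Definition smooth_on E (f : 'rV[R]_N -> R) : Prop :=
  forall k, class_C k E f.

(* C^2 up to the boundary: C^2 on some open neighbourhood of the closure. *)
Definition class_C2_closure Om (f : 'rV[R]_N -> R) : Prop :=
  exists U : set 'rV[R]_N, [/\ open U, closure Om `<=` U & class_C 2 U f].

(* Semicontinuity relative to E; the values of u outside E are irrelevant. *)
Definition usc_on E (u : 'rV[R]_N -> R) : Prop :=
  forall x, E x -> forall a, u x < a -> \forall y \near within E (nbhs x), u y < a.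

Definition lsc_on E (u : 'rV[R]_N -> R) : Prop :=
  forall x, E x -> forall a, a < u x -> \forall y \near within E (nbhs x), a < u y.

(* F x r p X, evaluated as F x (u x) (grad u x) (hess u x). *)
Definition operator := 'rV[R]_N -> R -> 'rV[R]_N -> 'M[R]_N -> R.

Definition linear_op (A : 'rV[R]_N -> 'M[R]_N) (b : 'rV[R]_N -> 'rV[R]_N)
    (c : 'rV[R]_N -> R) : operator :=
  fun x r p X => - \tr (A x *m X) - dotrv (b x) p - c x * r.

(* - eps Laplacian + F *)
Definition regularized (eps : R) (F : operator) : operator :=
  fun x r p X => - eps * \tr X + F x r p X.

Definition dirichlet_subsolution (F : operator) Om (u : 'rV[R]_N -> R) : Prop :=
  usc_on (closure Om) u /\
  forall (phi : 'rV[R]_N -> R) xi,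
    class_C2_closure Om phi -> closure Om xi ->
    (forall x, closure Om x -> u x - phi x <= u xi - phi xi) ->
    (Om xi -> F xi (u xi) (grad phi xi) (hess phi xi) <= 0) /\
    (boundary Om xi ->
       Num.max (u xi) (F xi (u xi) (grad phi xi) (hess phi xi)) <= 0).

Definition MP (F : operator) Om : Prop :=
  forall u, dirichlet_subsolution F Om u -> forall x, closure Om x -> u x <= 0.

(* F[phi] - lambda phi >= 0 in Om, in the viscosity sense *)
Definition supersolution (F : operator) (lambda : R) Om
    (phi : 'rV[R]_N -> R) : Prop :=
  forall (psi : 'rV[R]_N -> R) x0,
    class_C 2 Om psi -> Om x0 ->
    (\forall x \near nbhs x0, phi x0 - psi x0 <= phi x - psi x) ->
    0 <= F x0 (phi x0) (grad psi x0) (hess psi x0) - lambda * phi x0.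

Definition lambda1 (F : operator) Om : \bar R :=
  ereal_sup [set lambda%:E | lambda in [set lambda : R |
    exists phi : 'rV[R]_N -> R,
      [/\ lsc_on Om phi, (forall x, Om x -> 0 < phi x)
        & supersolution F lambda Om phi]]].

Definition lambda1_bar (F : operator) Om : \bar R :=
  ereal_sup [set lambda%:E | lambda in [set lambda : R |
    exists phi : 'rV[R]_N -> R,
      [/\ lsc_on Om phi, (0 < ereal_inf [set (phi x)%:E | x in Om])%E
        & supersolution F lambda Om phi]]].

(* lambda is the eigenvalue of a positive classical Dirichlet eigenfunction;
   at most one such lambda exists when G is regularized eps F with F linear
   degenerate elliptic, eps > 0 and coefficients continuous on closure Om. *)
Definition is_principal_eigenvalue (G : operator) Om (lambda : R) : Prop :=
  exists phi : 'rV[R]_N -> R,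
    [/\ class_C 2 Om phi,
        {within closure Om, continuous phi},
        (forall x, Om x -> 0 < phi x),
        (forall x, boundary Om x -> phi x = 0)
      & (forall x, Om x -> G x (phi x) (grad phi x) (hess phi x) = lambda * phi x)].

(* The default -oo, taken when there is no principal eigenvalue, keeps a lower
   bound on the eigenvalue from holding vacuously. *)
Definition principal_eigenvalue (G : operator) Om : \bar R :=
  xget -oo%E [set lambda%:E | lambda in is_principal_eigenvalue G Om].

Definition lambda_star (F : operator) Om : \bar R :=
  limf_einf (fun eps : R => principal_eigenvalue (regularized eps F) Om) (0^'+).

End Definitions.

Arguments operator : clear implicits.

Definition psd {R : realType} {n : nat} (X : 'M[R]_n) : Prop :=
  X^T = X /\ forall v : 'rV[R]_n, 0 <= dotrv (v *m X) v.

(* The Loewner order on symmetric matrices. *)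
Definition mx_le {R : realType} {n : nat} (X Y : 'M[R]_n) : Prop := psd (Y - X).

Definition structure_condition {R : realType} {N : nat} (F : operator R N)
    (O : set 'rV[R]_N) : Prop :=
  forall M : R, 0 < M ->
  exists omega : R -> R,
    [/\ {within `[0, +oo[, continuous omega}, omega 0 = 0
      & forall (X Y : 'M[R]_N) (sigma : R),
          X^T = X -> Y^T = Y -> 0 < sigma ->
          mx_le (- (3 * sigma) *: block_mx 1%:M 0 0 1%:M) (block_mx X 0 0 (- Y)) ->
          mx_le (block_mx X 0 0 (- Y))
                ((3 * sigma) *: block_mx 1%:M (- 1%:M) (- 1%:M) 1%:M) ->
          forall x y r, O x -> O y -> `|r| <= M ->
            F y r (sigma *: (x - y)) Y - F x r (sigma *: (x - y)) X
              <= omega (sigma * enorm (x - y) ^+ 2 + enorm (x - y))].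

Definition admissible {R : realType} {N : nat} (Om O : set 'rV[R]_N)
    (A : 'rV[R]_N -> 'M[R]_N) (b : 'rV[R]_N -> 'rV[R]_N) (c : 'rV[R]_N -> R) : Prop :=
  [/\ [/\ bounded_domain Om, open O & closure Om `<=` O],
      (forall x, O x -> psd (A x)),
      (forall x, O x ->
        [/\ {for x, continuous A}, {for x, continuous b} & {for x, continuous c}])
    & [/\ (forall i j, smooth_on Om (fun x => A x i j)),
          (forall i, smooth_on Om (fun x => b x 0 i))
        & smooth_on Om c]].

(* Main.v *)
Require Import Defs.
From mathcomp Require Import all_boot all_order all_algebra.
From mathcomp Require Import all_classical all_reals all_analysis.
From mathcomp Require Import ring lra.

Set Implicit Arguments.
Unset Strict Implicit.
Unset Printing Implicit Defensive.

Import Order.TTheory GRing.Theory Num.Theory.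
Import numFieldNormedType.Exports.

Local Open Scope classical_set_scope.
Local Open Scope ring_scope.

(** All three counterexamples are first order and one-dimensional: they have the
form F[u] = k u' - c u on an interval ]0, L[, with A = 0.

For conditions (i) and (ii) take L = pi, k = 2 sin and c = 2 cos - 1. The field
k is Lipschitz and vanishes at both endpoints, so the boundary inequality for
F holds trivially wherever u = 0. Two solutions live side by side:
- F[sin] = sin, so sin is a positive supersolution for lambda = 1, which gives
  lambda_1 >= 1. Since sin'' = - sin, sin is also a Dirichlet eigenfunction of
  F[u] - eps u'', with eigenvalue 1 + eps. A Wronskian argument
  ([sturm_lower_bound]) shows that no positive eigenfunction has a smaller
  eigenvalue, whence lambda_* >= 1.
- F[u] = 0 for u = sqrt (sin (1 + cos)), which is positive inside, vanishes at
  both endpoints and thus violates MP. The eigenfunction sin cannot be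
  compared with u near 0, because u / sin blows up there.

For condition (iii) the supersolution phi must stay away from 0 while
phi' / phi >= (c + lambda) / k, which is possible near 0 if 1 / k is integrable
there. Take L = 1, k = sqrt x (1 - x) and c = 1 / 4. Then 1 / (1 - sqrt x) >= 1
is a supersolution for lambda = 1 / 4, whereas (2 + sqrt x) (1 - x) is a
subsolution: it is positive at 0, but its slope there is +oo, so no C^2 function
touches it from above and the boundary condition at 0 holds vacuously ([steep_not_touched]). *)

(** * The line as the space of row vectors of size one *)

Definition pt {R : realType} (t : R) : 'rV[R]_1 := const_mx t.

Definition segment {R : realType} (L : R) : set 'rV[R]_1 :=
  [set x | 0 < x 0 0 < L].

Section RowVectorsOfSizeOne.
Context {R : realType}.
Implicit Types (x : 'rV[R]_1) (t L : R) (E : set 'rV[R]_1).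

Lemma pt_coord x : pt (x 0 0) = x.
Proof. by apply/rowP => i; rewrite mxE ord1. Qed.

Lemma coord_pt t : (pt t : 'rV[R]_1) 0 0 = t.
Proof. by rewrite mxE. Qed.

Lemma comp_ptK (T : Type) (f : 'rV[R]_1 -> T) : (fun x => (f \o pt) (x 0 0)) = f.
Proof. by apply/funext => x /=; rewrite pt_coord. Qed.

Lemma pt_continuous : continuous (@pt R).
Proof.
have -> : @pt R = fun t => t *: pt 1.
  by apply/funext => t; apply/rowP => i; rewrite !mxE mulr1.
by move=> t; apply: cvgZr_tmp; exact: cvg_id.
Qed.

Lemma coord0_continuous : continuous (fun x => x 0 0).
Proof. exact: coord_continuous. Qed.

Lemma continuous_comp_coord (T : topologicalType) (g : R -> T) x :
  {for x 0 0, continuous g} -> 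
  {for x, continuous (fun y : 'rV[R]_1 => g (y 0 0))}.
Proof. by move=> gc; apply: continuous_comp => //; exact: coord0_continuous. Qed.

Lemma near_pt x (P : set 'rV[R]_1) :
  (\forall y \near nbhs x, P y) -> \forall t \near nbhs (x 0 0), P (pt t).
Proof.
move=> Px; have := @pt_continuous (x 0 0) P.
by rewrite pt_coord; apply.
Qed.

Lemma difference_quotient_rV1 (f : 'rV[R]_1 -> R) x :
  (fun h : R => h^-1 *: ((f \o shift x) (h *: delta_mx 0 0) - f x)) =
  (fun h : R => h^-1 *: ((f \o pt \o shift (x 0 0)) (h *: 1) - (f \o pt) (x 0 0))).
Proof.
apply/funext => h /=; rewrite pt_coord; congr (_ *: (f _ - _)).
by apply/rowP => i; rewrite !mxE !ord1.
Qed.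

Lemma derive_rV1 (f : 'rV[R]_1 -> R) x :
  'D_(delta_mx 0 0) f x = 'D_1 (f \o pt) (x 0 0).
Proof. by rewrite /derive difference_quotient_rV1. Qed.

Lemma derivable_rV1 (f : 'rV[R]_1 -> R) x :
  derivable f x (delta_mx 0 0) = derivable (f \o pt) (x 0 0) 1.
Proof. by rewrite /derivable difference_quotient_rV1. Qed.

Lemma class_C_is_derive k E (f : 'rV[R]_1 -> R) x : class_C k.+1 E f -> E x ->
  is_derive (x 0 0) 1 (f \o pt) ('D_(delta_mx 0 0) f x).
Proof.
move=> [_ /(_ 0)[df _]] Ex; rewrite derive_rV1.
by apply: derivableP; rewrite -derivable_rV1; apply: df.
Qed.

Lemma is_derive_pt E (f : 'rV[R]_1 -> R) (g : R -> R) x d : open E -> E x ->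
  (forall y, E y -> f y = g (y 0 0)) -> is_derive (x 0 0) 1 g d ->
  is_derive (x 0 0) 1 (f \o pt) d.
Proof.
move=> oE Ex fg; apply: near_eq_is_derive.
have /near_pt : \forall y \near nbhs x, E y by exact: open_nbhs_nbhs.
by apply: filterS => t /fg /= ->; rewrite coord_pt.
Qed.

(** Iterated derivatives of f need not be written down: it is enough that f lies
in a class of functions which differentiation maps to itself. Only the values on
E matter, so f may agree with a member of P on E alone. *)
Lemma smooth_on_family (P : (R -> R) -> Prop) E : open E ->
  (forall g, P g -> exists2 dg, P dg &
     forall x, E x -> is_derive (x 0 0) 1 g (dg (x 0 0))) ->
  forall f : 'rV[R]_1 -> R,
  (exists2 g, P g & forall x, E x -> f x = g (x 0 0)) -> smooth_on E f.
Proof.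
move=> oE closedP.
have step f : (exists2 g, P g & forall x, E x -> f x = g (x 0 0)) ->
    (forall x, E x -> {for x, continuous f}) /\
    exists2 dg, P dg &
      forall x, E x -> is_derive (x 0 0) 1 (f \o pt) (dg (x 0 0)).
  case=> g Pg fg; have [dg Pdg gdg] := closedP g Pg.
  have fdg x : E x -> is_derive (x 0 0) 1 (f \o pt) (dg (x 0 0)).
    by move=> Ex; exact: is_derive_pt oE Ex fg (gdg x Ex).
  split; last by exists dg.
  move=> x Ex; rewrite -(comp_ptK f); apply: continuous_comp_coord.
  apply/differentiable_continuous/derivable1_diffP.
  by have [] := fdg x Ex.
move=> f ef k; elim: k f ef => [|k IHk] f /step[fc [dg Pdg fdg]]; split => //.
move=> i; rewrite ord1; split.
  by move=> x Ex; rewrite derivable_rV1; have [] := fdg x Ex.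
apply: IHk; exists dg => // x Ex.
by rewrite derive_rV1; have [] := fdg x Ex.
Qed.

Lemma segment_open L : open (segment L).
Proof.
have -> : segment L = (fun x => x 0 0) @^-1` `]0, L[.
  by apply/seteqP; split=> x; rewrite /segment /= in_itv.
by apply: open_comp; [move=> x _; exact: coord0_continuous|exact: itv_open].
Qed.

Lemma segment_ptE L : segment L = @pt R @` `]0, L[.
Proof.
apply/seteqP; split=> [x Lx | _ [t tL <-]]; rewrite /segment /=.
  by exists (x 0 0); rewrite ?pt_coord//= in_itv.
by rewrite coord_pt; rewrite /= in_itv in tL.
Qed.

Lemma segment_bounded_domain L : 0 < L -> bounded_domain (segment L).
Proof.
move=> L0; split.
- by exists (pt (L / 2)); rewrite /segment /= coord_pt; apply/andP; split; lra.
- exact: segment_open.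
- rewrite segment_ptE; apply: connected_continuous_connected.
    by apply/connected_intervalP; exact: interval_is_interval.
  by apply: continuous_subspaceT; exact: pt_continuous.
- rewrite /bounded_set /bounded_near; near=> M => x /andP[x0 xL].
  apply: (@le_trans _ _ L); last by near: M; apply: nbhs_pinfty_ge; exact: num_real.
  rewrite [`|x|]mx_normrE; apply: bigmax_le => [|[i j] _].
    by rewrite ltW ?(lt_trans x0).
  by rewrite !ord1 gtr0_norm// ltW.
Unshelve. all: by end_near. Qed.

Lemma closure_segment L : 0 < L -> closure (segment L) = [set x | 0 <= x 0 0 <= L].
Proof.
move=> L0; apply/seteqP; split.
  have cl : closed [set x : 'rV[R]_1 | 0 <= x 0 0 <= L].
    rewrite (_ : [set _ | _] = (fun x => x 0 0) @^-1` `[0, L]).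
      by apply: closed_comp; [move=> x _; exact: coord0_continuous|exact: itv_closed].
    by apply/seteqP; split=> x; rewrite /= in_itv.
  rewrite [X in _ `<=` X](closure_id _).1//; apply: closure_subset => x /=.
  by move=> /andP[x0 xL]; rewrite !ltW.
move=> x /= xL B /near_pt Bx.
(* Points of the closed interval are pushed inside, towards its midpoint. *)
pose path h := x 0 0 + h * (L / 2 - x 0 0).
have path_cvg : path h @[h --> 0^'+] --> x 0 0.
  rewrite -[X in _ --> X]addr0 -[X in _ --> _ + X](mul0r (L / 2 - x 0 0)).
  apply: cvgD; first exact: cvg_cst.
  by apply: cvgM; [apply: cvg_at_right_filter; exact: cvg_id|exact: cvg_cst].
have pathB : \forall h \near 0^'+, B (pt (path h)) by exact: path_cvg Bx.
near (0 : R)^'+ => h.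
exists (pt (path h)); split; last by near: h.
have h0 : 0 < h by near: h; exact: nbhs_right_gt.
have h1 : h < 1 by near: h; exact: nbhs_right_lt.
rewrite /segment /= coord_pt /path.
by apply/andP; split; nra.
Unshelve. all: by end_near. Qed.

Lemma boundary_segment L : 0 < L ->
  boundary (segment L) = [set x | x 0 0 = 0 \/ x 0 0 = L].
Proof.
move=> L0; rewrite /boundary closure_segment // (interior_id _).1;
  last exact: segment_open.
apply/seteqP; split=> x; rewrite /segment /=.
  move=> [/andP[x0 xL] nx]; have [->|x_neq0] := eqVneq (x 0 0) 0; first by left.
  right; apply/eqP; apply: contra_notT nx => x_neqL.
  by rewrite !lt_neqAle x0 xL x_neqL eq_sym x_neq0.
by case=> ->; rewrite !lexx ltxx ?andbF ?ltW.
Qed.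
End RowVectorsOfSizeOne.

(** * First-order operators on an interval *)

Definition transport {R : realType} (k c : R -> R) : operator R 1 :=
  linear_op (fun=> 0) (fun x => pt (- k (x 0 0))) (fun x => c (x 0 0)).

Section TransportOperators.
Context {R : realType}.
Implicit Types (k c u du g dg : R -> R) (x p : 'rV[R]_1) (L t : R).

Lemma dotrv1 x p : dotrv x p = x 0 0 * p 0 0.
Proof. by rewrite /dotrv !mxE big_ord1 !mxE. Qed.

Lemma transportE k c x r p X :
  transport k c x r p X = k (x 0 0) * p 0 0 - c (x 0 0) * r.
Proof.
by rewrite /transport /linear_op mul0mx mxtrace0 dotrv1 coord_pt; ring.
Qed.

Lemma grad1 (f : 'rV[R]_1 -> R) x : grad f x 0 0 = 'D_(delta_mx 0 0) f x.
Proof. by rewrite mxE. Qed.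

Lemma regularized_transportE k c eps x r p (X : 'M[R]_1) :
  regularized eps (transport k c) x r p X =
  - eps * X 0 0 + k (x 0 0) * p 0 0 - c (x 0 0) * r.
Proof. by rewrite /regularized transportE /mxtrace big_ord1; ring. Qed.

Lemma transport_admissible L k c : 0 < L -> continuous k -> continuous c ->
  smooth_on (segment L) (fun x => - k (x 0 0)) ->
  smooth_on (segment L) (fun x => c (x 0 0)) ->
  admissible (segment L) setT (fun=> 0) (fun x => pt (- k (x 0 0)))
    (fun x => c (x 0 0)).
Proof.
move=> L0 kc cc ks cs; split.
- by split; [exact: segment_bounded_domain | exact: openT | ].
- move=> x _; split; first exact: trmx0.
  by move=> v; rewrite dotrv1 mulmx0 mxE mul0r.
- move=> x _; split.
  + exact: cst_continuous.
  + apply: (@continuous_comp_coord _ _ (pt \o (fun t => - k t))).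
    by apply: continuous_comp; [apply: cvgN; exact: kc | exact: pt_continuous].
  + by apply: continuous_comp_coord; exact: cc.
- split => //.
  + move=> i j; apply: (@smooth_on_family _ (fun g => g = cst 0)).
    * exact: segment_open.
    * by move=> g ->; exists (cst 0) => // x _; exact: is_derive_cst.
    * by exists (cst 0) => // x _; rewrite mxE.
  + by move=> i; under eq_fun do rewrite mxE.
Qed.

Lemma derive_at_local_extremum g t : (\forall s \near t, derivable g s 1) ->
  (\forall s \near t, g t <= g s) \/ (\forall s \near t, g s <= g t) ->
  'D_1 g t = 0.
Proof.
move=> dg gext; have [] : is_derive t 1 g 0; last by [].
have nearby (P : R -> Prop) : (\forall s \near t, P s) -> exists2 e : R, 0 < e &
    forall s, s \in `]t - e, t + e[ -> derivable g s 1 /\ P s.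
  move=> Pt; have /nbhs_ballP[e /= e0 He] : \forall s \near t, derivable g s 1 /\ P s.
    exact: filterI.
  by exists e => // s st; apply: He; rewrite ball_itv.
case: gext => /nearby[e e0 He];
  [apply: (@derive1_at_min _ g (t - e) (t + e)) |
   apply: (@derive1_at_max _ g (t - e) (t + e))].
all: try by [lra | rewrite in_itv /=; apply/andP; split; lra].
all: by move=> s /He[].
Qed.

(** At an interior point where the candidate is differentiable, every test
function has the same gradient as the candidate. The viscosity inequalities of a
first-order operator therefore reduce to pointwise ones. *)
Lemma touching_gradient L g dg (psi : 'rV[R]_1 -> R) (U : set 'rV[R]_1) x :
  (forall t, 0 < t < L -> is_derive t 1 g (dg t)) ->
  class_C 2 U psi -> segment L `<=` U -> segment L x ->
  (\forall y \near x, psi x - g (x 0 0) <= psi y - g (y 0 0)) \/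
  (\forall y \near x, psi y - g (y 0 0) <= psi x - g (x 0 0)) ->
  grad psi x 0 0 = dg (x 0 0).
Proof.
move=> gdg Cpsi LU Lx xext; rewrite grad1.
pose w := (psi \o pt) \- g.
have wd y : segment L y ->
    is_derive (y 0 0) 1 w ('D_(delta_mx 0 0) psi y - dg (y 0 0)).
  move=> Ly; apply: is_deriveB; last exact: gdg.
  by apply: class_C_is_derive Cpsi _; exact: LU.
apply/eqP; rewrite -subr_eq0; apply/eqP.
have [_ <-] := wd x Lx.
apply: derive_at_local_extremum.
  have /near_pt : \forall y \near nbhs x, segment L y.
    by apply: open_nbhs_nbhs; split => //; exact: segment_open.
  by apply: filterS => s /wd[]; rewrite coord_pt.
case: xext => /near_pt xext; [left|right]; apply: filterS xext => s;
  by rewrite /w /= pt_coord coord_pt.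
Qed.

Lemma transport_supersolution L k c lam g dg :
  (forall t, 0 < t < L -> is_derive t 1 g (dg t)) ->
  (forall t, 0 < t < L -> lam * g t <= k t * dg t - c t * g t) ->
  supersolution (transport k c) lam (segment L) (fun x => g (x 0 0)).
Proof.
move=> gdg glam psi x Cpsi Lx xmin.
rewrite transportE (touching_gradient gdg Cpsi _ Lx) //.
  by rewrite subr_ge0; exact: glam.
by right; apply: filterS xmin => y; lra.
Qed.

Lemma is_derive_lsc_on L g dg :
  (forall t, 0 < t < L -> is_derive t 1 g (dg t)) ->
  lsc_on (segment L) (fun x => g (x 0 0)).
Proof.
move=> gdg x Lx a ax.
have gx : {for x, continuous (fun y : 'rV[R]_1 => g (y 0 0))}.
  apply: continuous_comp_coord; apply/differentiable_continuous/derivable1_diffP.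
  by have [] := gdg _ Lx.
by rewrite near_withinE; apply: filterS (cvgr_gt (F := nbhs x) _ gx _ ax) => y /= ay _.
Qed.

(** A differentiable g grows at most linearly from a, hence cannot stay above a
function u that leaves the common value with infinite slope. *)
Lemma steep_not_touched g u (a D : R) : is_derive a 1 g D ->
  (forall p : R, \forall h \near 0^'+, p * h < u (a + h) - u a) ->
  \forall h \near 0^'+, u a - g a < u (a + h) - g (a + h).
Proof.
move=> [dg gD] steep.
have gq : h^-1 * (g (a + h) - g a) @[h --> 0^'+] --> D.
  apply: cvg_dnbhs_at_right; rewrite -gD.
  rewrite [X in X @ _ --> _](_ : _ =
    (fun h => h^-1 *: ((g \o shift a) (h *: 1) - g a))) //.
  by apply/funext => h /=; rewrite [h *: 1]mulr1 [h + a]addrC.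
have {}gq := cvgr_lt (F := 0^'+) _ gq (D + 1).
near=> h.
have h0 : 0 < h by near: h; exact: nbhs_right_gt.
have : h^-1 * (g (a + h) - g a) < D + 1 by near: h; apply: gq; lra.
rewrite mulrC ltr_pdivrMr // => glt.
have : (D + 1) * h < u (a + h) - u a by near: h; exact: steep.
lra.
Unshelve. all: by end_near. Qed.

(** At an endpoint, either k and u both vanish, so that F(xi, u, p, X) = 0
whatever the test function is, or u is so steep that no test function exists. *)
Lemma transport_not_MP L k c u du : 0 < L -> continuous u ->
  (forall t, 0 < t < L -> is_derive t 1 u (du t)) ->
  (forall t, 0 < t < L -> k t * du t <= c t * u t) ->
  (k 0 = 0 /\ u 0 = 0) \/ (forall p : R, \forall h \near 0^'+, p * h < u h - u 0) ->
  k L = 0 -> u L = 0 -> (exists2 t, 0 < t < L & 0 < u t) ->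
  ~ MP (transport k c) (segment L).
Proof.
move=> L0 uc udu usub u0 kL uL [t tL ut] /(_ (fun x => u (x 0 0))) mp.
have : u t <= 0; last by lra.
suff /mp /(_ (pt t)) : dirichlet_subsolution (transport k c) (segment L)
    (fun x => u (x 0 0)).
  by rewrite coord_pt; apply; apply: subset_closure; rewrite /segment /= coord_pt.
split=> [x _ a xa|phi xi [U [oU LU Cphi]] clxi ximax].
  have ux := continuous_comp_coord (uc (x 0 0)).
  by rewrite near_withinE; apply: filterS (cvgr_lt (F := nbhs x) _ ux _ xa).
split=> [Lxi|].
  rewrite transportE.
  have LUo : segment L `<=` U by move=> y Ly; apply: LU; exact: subset_closure.
  rewrite (touching_gradient udu Cphi LUo Lxi) ?subr_le0; first exact: usub.
  left; have : \forall y \near xi, segment L y.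
    by apply: open_nbhs_nbhs; split => //; exact: segment_open.
  apply: filterS => y /subset_closure /ximax; lra.
have flat : k (xi 0 0) = 0 -> u (xi 0 0) = 0 ->
    Num.max (u (xi 0 0)) (transport k c xi (u (xi 0 0)) (grad phi xi) (hess phi xi)) <= 0.
  by move=> k0 v0; rewrite transportE k0 v0 ge_max; apply/andP; split; lra.
rewrite boundary_segment // => -[xi0|xiL]; last by apply: flat; rewrite xiL.
case: u0 => [[k0 v0]|steep]; first by apply: flat; rewrite xi0.
have U0 : U xi by exact: LU.
have dphi := class_C_is_derive Cphi U0; rewrite xi0 in dphi.
have steep0 (p : R) : \forall h \near 0^'+, p * h < u (0 + h) - u 0.
  by apply: filterS (steep p) => h; rewrite add0r.
have not_touched := steep_not_touched dphi steep0.
near (0 : R)^'+ => h.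
have : u 0 - phi (pt 0) < u h - phi (pt h).
  by rewrite -[h]add0r; near: h.
have h0 : 0 < h by near: h; exact: nbhs_right_gt.
have hL : h < L by near: h; exact: nbhs_right_lt.
have := ximax (pt h); rewrite closure_segment //= coord_pt xi0.
have -> : phi xi = phi (pt 0) by rewrite -xi0 pt_coord.
have -> : 0 <= h <= L by apply/andP; split; exact: ltW.
by move=> /(_ isT); lra.
Unshelve. all: by end_near. Qed.

End TransportOperators.

(** * Monotonicity from the sign of the derivative *)

Section Monotonicity.
Context {R : realType}.
Implicit Types (g dg : R -> R) (a b s t : R).

Lemma is_derive_ndecr g dg a b :
  (forall t, a < t < b -> is_derive t 1 g (dg t)) ->
  (forall t, a < t < b -> 0 <= dg t) ->
  forall s t, a < s -> s <= t -> t < b -> g s <= g t.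
Proof.
move=> gdg dg0 s t as_ st tb; apply: (@ger0_derive1_le_oo _ g a b) => //.
- by move=> x; rewrite in_itv => /gdg[].
- by move=> x; rewrite in_itv /= derive1E => xab; have [_ ->] := gdg x xab; exact: dg0.
- move=> x; rewrite inE /= in_itv => /gdg[dgx _].
  exact/differentiable_continuous/derivable1_diffP.
- by rewrite in_itv /= as_ (le_lt_trans st).
- by rewrite in_itv /= tb (lt_le_trans as_).
Qed.

Lemma is_derive_incr g dg a b :
  (forall t, a < t < b -> is_derive t 1 g (dg t)) ->
  (forall t, a < t < b -> 0 < dg t) ->
  forall s t, a < s -> s < t -> t < b -> g s < g t.
Proof.
move=> gdg dg0 s t as_ st tb; apply: (@gtr0_derive1_lt_oo _ g a b) => //.
- by move=> x; rewrite in_itv => /gdg[].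
- by move=> x; rewrite in_itv /= derive1E => xab; have [_ ->] := gdg x xab; exact: dg0.
- move=> x; rewrite inE /= in_itv => /gdg[dgx _].
  exact/differentiable_continuous/derivable1_diffP.
- by rewrite in_itv /= as_ (lt_trans st).
- by rewrite in_itv /= tb (lt_trans as_).
Qed.

Lemma is_derive_mul (g h : R -> R) (d e t : R) :
  is_derive t 1 g d -> is_derive t 1 h e ->
  is_derive t 1 (fun s => g s * h s) (d * h t + g t * e).
Proof.
move=> gd hd; apply: (is_derive_eq (is_deriveM gd hd)).
by rewrite /GRing.scale /=; ring.
Qed.
End Monotonicity.

(** * Condition (iii): a speed with a square root *)

Section SquareRootTransport.
Context {R : realType}.
Implicit Types (t : R).

Definition root_speed t : R := Num.sqrt t * (1 - t).

Lemma root_transport_smooth :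
  smooth_on (segment 1) (fun x => - root_speed (x 0 0)).
Proof.
apply: (@smooth_on_family _ (fun g => exists abp : R * R * R,
  g = fun t => abp.1.1 * t `^ abp.2 + abp.1.2 * t `^ (abp.2 + 1))).
- exact: segment_open.
- move=> _ [[[a b] p] /= ->].
  exists (fun t => (a * p) * t `^ (p - 1) + (b * (p + 1)) * t `^ (p - 1 + 1)).
    by exists (a * p, b * (p + 1), p - 1).
  move=> x /andP[x0 _].
  have dpow q : is_derive (x 0 0) 1 (fun t => t `^ q) (q * x 0 0 `^ (q - 1)).
    exact: is_derive1_powR.
  have dab := is_deriveD (is_deriveZ a (dpow p)) (is_deriveZ b (dpow (p + 1))).
  apply: (is_derive_eq dab).
  by rewrite /GRing.scale /= !mulrA addrK subrK.
(* The combinations of t `^ p and t `^ (p + 1) are mapped by differentiation to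
   those with p - 1 in place of p; the speed is the case p = 1 / 2. *)
- exists (fun t => -1 * t `^ 2^-1 + 1 * t `^ (2^-1 + 1)).
    by exists (-1, 1, 2^-1).
  move=> x /andP[x0 _].
  rewrite powRD ?(gt_eqF x0) ?implybT // powRr1 ?ltW // powR12_sqrt ?ltW //.
  by rewrite /root_speed; ring.
Qed.

Lemma sqrt_lt1 t : 0 < t < 1 -> 0 < Num.sqrt t < 1.
Proof.
by move=> /andP[t0 t1]; rewrite sqrtr_gt0 t0 -[ltRHS]sqrtr1 ltr_sqrt // ltr01.
Qed.

Lemma root_speed_continuous : continuous root_speed.
Proof.
move=> t; apply: cvgM; first exact: sqrt_continuous.
by apply: cvgB; [exact: cvg_cst | exact: cvg_id].
Qed.

Lemma root_transport_admissible :
  admissible (segment 1) setT (fun=> 0) (fun x => pt (- root_speed (x 0 0)))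
    (fun=> 4^-1).
Proof.
apply: (@transport_admissible R 1 root_speed (cst 4^-1)) => //.
- exact: root_speed_continuous.
- by move=> t; exact: cst_continuous.
- exact: root_transport_smooth.
- apply: (@smooth_on_family _ (fun g => exists a : R, g = cst a)).
  + exact: segment_open.
  + move=> _ [a ->]; exists (cst 0); first by exists 0.
    by move=> x _; exact: is_derive_cst.
  + by exists (cst 4^-1) => //; exists 4^-1.
Qed.

(** The subsolution (2 + sqrt t) (1 - t) is positive at 0, where it cannot be
touched from above, and vanishes together with the speed at 1. *)
Lemma root_transport_not_MP : ~ MP (transport root_speed (cst 4^-1)) (segment 1).
Proof.
pose u t : R := (2 + Num.sqrt t) * (1 - t).
pose du t : R := (2 * Num.sqrt t)^-1 * (1 - t) - (2 + Num.sqrt t).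
apply: (@transport_not_MP _ 1 _ _ u du) => //.
- move=> t; apply: cvgM.
    by apply: cvgD; [exact: cvg_cst | exact: sqrt_continuous].
  by apply: cvgB; [exact: cvg_cst | exact: cvg_id].
- move=> t /andP[t0 t1].
  have d1 : is_derive t 1 (fun s => 2 + Num.sqrt s) (2 * Num.sqrt t)^-1.
    have d := is_deriveD (is_derive_cst (2 : R) t 1) (is_derive1_sqrt t0).
    by apply: (is_derive_eq d); rewrite add0r.
  have d2 : is_derive t 1 (fun s : R => 1 - s) (- 1).
    have d := is_deriveB (is_derive_cst (1 : R) t 1) (is_derive_id t (1 : R)).
    by apply: (is_derive_eq d); rewrite sub0r.
  by apply: (is_derive_eq (is_derive_mul d1 d2)); rewrite /du; ring.
- move=> t t01; have /andP[s0 s1] := sqrt_lt1 t01; move/andP: t01 => [t0 t1].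
  rewrite /root_speed /du /u /cst.
  have -> : Num.sqrt t * (1 - t) * ((2 * Num.sqrt t)^-1 * (1 - t) - (2 + Num.sqrt t)) =
     2^-1 * (1 - t) * (1 - t) - Num.sqrt t * (1 - t) * (2 + Num.sqrt t).
    by field; rewrite gt_eqF.
  have st : Num.sqrt t ^+ 2 = t by rewrite sqr_sqrtr // ltW.
  nra.
- right => p; rewrite /u sqrtr0 addr0 subr0.
  have small : (Num.sqrt h * (`|p| + 3)) @[h --> (0 : R)^'+] --> (0 : R).
    rewrite [X in _ --> X](_ : _ = Num.sqrt 0 * (`|p| + 3)).
      by apply: cvgM; [apply: cvg_at_right_filter; exact: sqrt_continuous
                      | exact: cvg_cst].
    by rewrite sqrtr0 mul0r.
  near=> h.
  have h0 : 0 < h by near: h; exact: nbhs_right_gt.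
  have [s0 st] : 0 < Num.sqrt h /\ Num.sqrt h ^+ 2 = h.
    by rewrite sqrtr_gt0 sqr_sqrtr // ltW.
  have hs : Num.sqrt h * (`|p| + 3) < 1.
    by near: h; exact: (cvgr_lt (F := 0^'+) _ small _ ltr01).
  have np := ler_norm p; have p0 := normr_ge0 p.
  move: s0 st hs; move: (Num.sqrt h) => s s0 <- hs.
  have ps : p * s <= `|p| * s by rewrite ler_pM2r.
  have ps0 : 0 <= `|p| * s by rewrite mulr_ge0 // ltW.
  have ss : s ^+ 2 <= s by rewrite expr2 ler_piMl; lra.
  have : 0 < s * (1 - p * s - 2 * s - s ^+ 2) by apply: mulr_gt0 => //; lra.
  by lra.
- by rewrite /root_speed subrr mulr0.
- by rewrite /u subrr mulr0.
- exists 2^-1; first by apply/andP; split; lra.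
  by rewrite /u mulr_gt0 //; have := sqrtr_ge0 (2^-1 : R); lra.
Unshelve. all: by end_near. Qed.

(** The supersolution (1 - sqrt t)^-1 is at least 1; that k g' >= g / 2 holds up
to the endpoint 0 is possible because 1 / k is integrable there. *)
Lemma root_transport_lambda1_bar :
  (0 < lambda1_bar (transport root_speed (cst (4^-1)%R)) (segment (1%R : R)))%E.
Proof.
pose g t : R := (1 - Num.sqrt t)^-1.
pose dg t : R := (2 * Num.sqrt t)^-1 * (1 - Num.sqrt t) ^- 2.
have gdg t : 0 < t < 1 -> is_derive t 1 g (dg t).
  move=> t01; have /andP[s0 s1] := sqrt_lt1 t01; move/andP: t01 => [t0 t1].
  have d1 := is_deriveB (is_derive_cst (1 : R) t 1) (is_derive1_sqrt t0).
  have nz : (cst 1 - Num.sqrt) t != 0 :> R by rewrite /= subr_eq0 gt_eqF.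
  apply: (is_derive_eq (is_deriveV nz d1)).
  by rewrite /dg /GRing.scale /=; ring.
apply: (@lt_le_trans _ _ (4^-1)%:E); first by rewrite lte_fin; lra.
apply: ereal_sup_ubound; exists 4^-1 => //; exists (fun x => g (x 0 0)); split.
- exact: is_derive_lsc_on gdg.
- apply: (@lt_le_trans _ _ 1%E); first by rewrite lte_fin.
  apply/ereal_infP => _ [x Lx <-]; rewrite lee_fin /g.
  have /andP[s0 s1] := sqrt_lt1 Lx.
  by rewrite invf_ge1; lra.
- apply: (transport_supersolution gdg) => t t01.
  have /andP[s0 s1] := sqrt_lt1 t01; move/andP: t01 => [t0 t1].
  have st : Num.sqrt t ^+ 2 = t by rewrite sqr_sqrtr // ltW.
  rewrite /root_speed /g /dg /cst -[X in _ * (1 - X) * _]st -subr_ge0.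
  rewrite [leRHS](_ : _ = Num.sqrt t / 2 * (1 - Num.sqrt t)^-1).
    by rewrite mulr_ge0 ?divr_ge0 ?invr_ge0 ?subr_ge0 ?ltW.
  by field; rewrite subr_eq0 !gt_eqF.
Qed.
End SquareRootTransport.

(** * Conditions (i) and (ii): a speed vanishing at both endpoints *)

Section SineTransport.
Context {R : realType}.
Implicit Types (t eps mu : R).

Definition sin_speed t : R := 2 * sin t.
Definition sin_potential t : R := 2 * cos t - 1.

(** Combinations of sin, cos and a constant are stable under differentiation. *)
Lemma trig_smooth (L a b d : R) (f : R -> R) :
  (forall t, f t = a * sin t + b * cos t + d) ->
  smooth_on (segment L) (fun x => f (x 0 0)).
Proof.
move=> fE.
apply: (@smooth_on_family _ (fun g => exists e : R * R * R,
  g = fun t => e.1.1 * sin t + e.1.2 * cos t + e.2)).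
- exact: segment_open.
- move=> _ [[[a' b'] d'] /= ->].
  exists (fun t => - b' * sin t + a' * cos t + 0); first by exists (- b', a', 0).
  move=> x _; have ds := is_deriveZ a' (is_derive_sin (x 0 0)).
  have dc := is_deriveZ b' (is_derive_cos (x 0 0)).
  apply: (is_derive_eq (is_deriveD (is_deriveD ds dc) (is_derive_cst d' _ _))).
  by rewrite /GRing.scale /=; ring.
- by exists f => //; exists (a, b, d); apply/funext.
Qed.

Lemma sin_transport_admissible :
  admissible (segment pi) setT (fun=> 0) (fun x => pt (- sin_speed (x 0 0)))
    (fun x => sin_potential (x 0 0)).
Proof.
apply: transport_admissible.
- exact: pi_gt0.
- by move=> t; apply: cvgM; [exact: cvg_cst | exact: continuous_sin].
- move=> t; apply: cvgB; last exact: cvg_cst.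
  by apply: cvgM; [exact: cvg_cst | exact: continuous_cos].
- apply: (@trig_smooth _ (- 2) 0 0 (fun t => - sin_speed t)) => t.
  by rewrite /sin_speed; ring.
- by apply: (@trig_smooth _ 0 2 (- 1)) => t; rewrite /sin_potential; ring.
Qed.

Lemma sin_lipschitz (s t : R) : `|sin s - sin t| <= `|s - t|.
Proof.
wlog st : s t / t <= s.
  move=> H; case/orP: (le_total t s) => [/H //|/H].
  by rewrite distrC [X in _ <= X]distrC.
have [|r _ ->] := @MVT_segment R sin cos t s st (fun x _ => is_derive_sin x).
  by apply: continuous_subspaceT; exact: continuous_sin.
by rewrite normrM ler_piMl // cos_max.
Qed.

Lemma cos_lipschitz (s t : R) : `|cos s - cos t| <= `|s - t|.
Proof.
rewrite -!sinDpihalf (_ : s - t = (s + pi / 2) - (t + pi / 2)); last by ring.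
exact: sin_lipschitz.
Qed.

Lemma enorm1 (x : 'rV[R]_1) : enorm x = `|x 0 0|.
Proof. by rewrite /enorm dotrv1 -expr2 sqrtr_sqr. Qed.

(** The second-order terms are absent, so the condition only asks that the speed
and the potential be Lipschitz: the modulus (2 + 2 M) t comes from the Lipschitz
constant 2 of both and from |r| <= M. *)
Lemma sin_transport_structure :
  structure_condition (transport sin_speed sin_potential) setT.
Proof.
move=> M M0; exists (fun t => (2 + 2 * M) * t); split.
- apply: continuous_subspaceT => t.
  by apply: cvgM; [exact: cvg_cst | exact: cvg_id].
- by rewrite mulr0.
move=> X Y sigma _ _ sigma0 _ _ x y r _ _ rM.
rewrite !transportE enorm1 !mxE /sin_speed /sin_potential.
move: (x 0 0) (y 0 0) => a b.
have -> : 2 * sin b * (sigma * (a - b)) - (2 * cos b - 1) * r -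
  (2 * sin a * (sigma * (a - b)) - (2 * cos a - 1) * r) =
  2 * (sigma * ((sin b - sin a) * (a - b))) + 2 * ((cos a - cos b) * r) by ring.
have sines : (sin b - sin a) * (a - b) <= `|a - b| ^+ 2.
  apply: le_trans (ler_norm _) _; rewrite normrM expr2 ler_wpM2r //.
  by rewrite -[leRHS]distrC sin_lipschitz.
have cosines : (cos a - cos b) * r <= `|a - b| * M.
  by apply: le_trans (ler_norm _) _; rewrite normrM ler_pM // cos_lipschitz.
have s1 : sigma * ((sin b - sin a) * (a - b)) <= sigma * `|a - b| ^+ 2.
  by rewrite ler_pM2l.
have s0 : 0 <= M * (sigma * `|a - b| ^+ 2).
  by rewrite !mulr_ge0 ?exprn_ge0 // ltW.
have := normr_ge0 (a - b); lra.
Qed.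

Lemma cos_gtN1 t : 0 < t < pi -> 0 < 1 + cos t.
Proof.
move=> /sin_gt0_pi s0; have := cos2Dsin2 t; have := exprn_gt0 2 s0; nra.
Qed.

(** With v = sin (1 + cos) one has v' = (1 + cos) (2 cos - 1), so sqrt v is an
exact solution of F[u] = 0 vanishing at both endpoints. *)
Lemma sin_transport_not_MP :
  ~ MP (transport sin_speed sin_potential) (segment pi).
Proof.
pose v t : R := sin t * (1 + cos t).
have v0 t : 0 < t < pi -> 0 < v t.
  by move=> t0; rewrite mulr_gt0 ?cos_gtN1 ?sin_gt0_pi.
apply: (@transport_not_MP _ pi _ _ (fun t => Num.sqrt (v t))
  (fun t => (2 * Num.sqrt (v t))^-1 * ((1 + cos t) * (2 * cos t - 1)))).
- exact: pi_gt0.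
- move=> t; apply: (@continuous_comp _ _ _ v); last exact: sqrt_continuous.
  apply: cvgM; first exact: continuous_sin.
  by apply: cvgD; [exact: cvg_cst | exact: continuous_cos].
- move=> t tpi.
  have d1 : is_derive t 1 (fun s => 1 + cos s) (- sin t).
    have d := is_deriveD (is_derive_cst (1 : R) t 1) (is_derive_cos t).
    by apply: (is_derive_eq d); rewrite add0r.
  have dv := is_derive_mul (is_derive_sin t) d1.
  apply: (is_derive_eq (is_derive1_comp (is_derive1_sqrt (v0 _ tpi)) dv)).
  rewrite /GRing.scale /=; congr (_ * _).
  have -> : sin t * - sin t = cos t ^+ 2 - 1 by rewrite -(cos2Dsin2 t); ring.
  by ring.
- move=> t tpi; rewrite le_eqVlt; apply/orP; left; apply/eqP.
  have := sqr_sqrtr (ltW (v0 t tpi)).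
  have : Num.sqrt (v t) != 0 by rewrite gt_eqF // sqrtr_gt0 v0.
  move: (Num.sqrt _) => w w0 wv.
  rewrite /sin_speed /sin_potential.
  have -> : 2 * sin t * ((2 * w)^-1 * ((1 + cos t) * (2 * cos t - 1))) =
    v t * w^-1 * (2 * cos t - 1) by rewrite /v; field.
  by rewrite -wv; field.
- by left; rewrite /sin_speed /v sin0 mul0r mulr0 sqrtr0.
- by rewrite /sin_speed sinpi mulr0.
- by rewrite /v sinpi mul0r sqrtr0.
- have pi0 := pi_gt0 R; exists (pi / 2); first by apply/andP; split; lra.
  by rewrite sqrtr_gt0 v0 //; apply/andP; split; lra.
Qed.

Lemma sin_transport_lambda1 :
  (0 < lambda1 (transport sin_speed sin_potential) (segment (pi : R)))%E.
Proof.
apply: (@lt_le_trans _ _ 1%E); first by rewrite lte_fin.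
have dsin t : 0 < t < pi -> is_derive t 1 sin (cos t).
  by move=> _; exact: is_derive_sin.
apply: ereal_sup_ubound; exists 1 => //; exists (fun x => sin (x 0 0)); split.
- exact: is_derive_lsc_on dsin.
- by move=> x Lx; exact: sin_gt0_pi.
- apply: (transport_supersolution dsin) => t _.
  by rewrite /sin_speed /sin_potential; lra.
Qed.

(** The potential 2 cos - 1 is chosen so that F[sin] = sin, and sin is an
eigenfunction of the Laplacian: the eigenfunction does not depend on eps. *)
Lemma sin_eigenfunction eps :
  is_principal_eigenvalue (regularized eps (transport sin_speed sin_potential))
    (segment pi) (1 + eps).
Proof.
have sin_smooth : smooth_on (segment pi) (fun x : 'rV[R]_1 => sin (x 0 0)).
  by apply: (@trig_smooth _ 1 0 0) => t; ring.
have compK (g : R -> R) : (fun x : 'rV[R]_1 => g (x 0 0)) \o pt = g.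
  by apply/funext => t /=; rewrite coord_pt.
have dsin x : 'D_(delta_mx 0 0) (fun y : 'rV[R]_1 => sin (y 0 0)) x = cos (x 0 0).
  by rewrite derive_rV1 compK derive_val.
exists (fun x => sin (x 0 0)); split.
- exact: sin_smooth.
- apply: continuous_subspaceT => x; apply: continuous_comp_coord.
  exact: continuous_sin.
- by move=> x Lx; exact: sin_gt0_pi.
- by move=> x; rewrite boundary_segment ?pi_gt0 // => -[]->; rewrite ?sin0 ?sinpi.
- move=> x Lx; rewrite regularized_transportE grad1 dsin !mxE (funext dsin).
  rewrite derive_rV1 compK derive_val.
  by rewrite /sin_speed /sin_potential; ring.
Qed.

(** Sturm comparison of f with sin. Let w = f' sin - f sin' be the Wronskian of
sin and f. If mu < 1 + eps, the two equations show that p w is increasing, with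
the integrating factor p = exp (2 cos / eps). So p w, and with it w, stays away
from 0 near one of the endpoints: w <= C < 0 near 0, or w >= C > 0 near pi. As
(f / sin)' = w / sin ^ 2, and C / sin ^ 2 is the derivative of - C cos / sin, the
function (f + C cos) / sin is then monotone near that endpoint. Hence
f >= K sin - C cos there for some K, which prevents f from tending to 0. *)
Lemma sturm_lower_bound eps mu (f df ddf : R -> R) : 0 < eps ->
  (forall t, 0 < t < pi -> is_derive t 1 f (df t)) ->
  (forall t, 0 < t < pi -> is_derive t 1 df (ddf t)) ->
  (forall t, 0 < t < pi -> 0 < f t) ->
  f t @[t --> 0^'+] --> (0 : R) -> f t @[t --> pi^'-] --> (0 : R) ->
  (forall t, 0 < t < pi ->
    - eps * ddf t + sin_speed t * df t - sin_potential t * f t = mu * f t) ->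
  1 + eps <= mu.
Proof.
move=> eps0 f1 f2 fpos f0 fpi ode; rewrite leNgt; apply/negP => mu_lt.
pose a := 2 / eps; have a0 : 0 < a by rewrite divr_gt0.
pose w t := df t * sin t - f t * cos t.
pose p t := expR (a * cos t).
have dw t : 0 < t < pi ->
    is_derive t 1 w (a * sin t * w t + (1 + eps - mu) / eps * f t * sin t).
  move=> tpi; have d1 := is_derive_mul (f2 t tpi) (is_derive_sin t).
  have d2 := is_derive_mul (f1 t tpi) (is_derive_cos t).
  apply: (is_derive_eq (is_deriveB d1 d2)).
  have -> : ddf t = (sin_speed t * df t - sin_potential t * f t - mu * f t) / eps.
    by apply: (mulIf (lt0r_neq0 eps0)); rewrite divfK ?lt0r_neq0 // -(ode t tpi); ring.
  by rewrite /w /sin_speed /sin_potential /a; field; rewrite lt0r_neq0.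
have dp t : is_derive t 1 p (- a * sin t * p t).
  have d1 := is_deriveZ a (is_derive_cos t).
  apply: (is_derive_eq (is_derive1_comp (is_derive_expR _) d1)).
  by rewrite /p /GRing.scale /=; ring.
have p0 t : 0 < p t by exact: expR_gt0.
have pw_incr : forall s t, 0 < s -> s < t -> t < pi -> p s * w s < p t * w t.
  apply: (@is_derive_incr _ (fun t => p t * w t) (fun t =>
    p t * ((1 + eps - mu) / eps * f t * sin t))).
    move=> t tpi; apply: (is_derive_eq (is_derive_mul (dp t) (dw t tpi))).
    by ring.
  move=> t tpi; rewrite !mulr_gt0 ?invr_gt0 ?fpos ?sin_gt0_pi // subr_gt0 //.
have p_bounds t : expR (- a) <= p t <= expR a.
  have /andP[c1 c2] : -1 <= cos t <= 1 by rewrite -ler_norml cos_max.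
  by rewrite /p !ler_expR; apply/andP; split; nra.
have dq C t : 0 < t < pi ->
    is_derive t 1 (fun s => (f s + C * cos s) / sin s) ((w t - C) / sin t ^+ 2).
  move=> tpi; have s0 := sin_gt0_pi tpi.
  have d1 : is_derive t 1 (fun s => f s + C * cos s) (df t - C * sin t).
    apply: (is_derive_eq (is_deriveD (f1 t tpi) (is_deriveZ C (is_derive_cos t)))).
    by rewrite /GRing.scale /=; ring.
  have d2 := is_deriveV (lt0r_neq0 s0) (is_derive_sin t).
  apply: (is_derive_eq (is_derive_mul d1 d2)).
  rewrite /w /GRing.scale /=.
  transitivity
    ((df t * sin t - f t * cos t - C * (cos t ^+ 2 + sin t ^+ 2)) / sin t ^+ 2).
    by field; rewrite lt0r_neq0.
  by rewrite cos2Dsin2 mulr1.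
have pi0 : (0 : R) < pi := pi_gt0 R.
have ea : 0 < expR a := expR_gt0 a.
have [h_le0|h_gt0] := leP (p (pi / 2) * w (pi / 2)) 0.
(* p w < 0 at pi / 4: the contradiction is obtained at the endpoint 0. *)
- pose m : R := pi / 4.
  have P0 : p m * w m < 0.
    by apply: lt_le_trans h_le0; apply: pw_incr; rewrite /m; lra.
  pose C := p m * w m / expR a.
  have C0 : C < 0 by rewrite ltr_pdivrMr // mul0r.
  have wC t : 0 < t < m -> w t <= C.
    move=> /andP[t0 tm]; rewrite ler_pdivlMr //.
    have pw : p t * w t < p m * w m by apply: pw_incr => //; rewrite /m; lra.
    have wt0 : w t < 0 by rewrite -(pmulr_rlt0 _ (p0 t)); lra.
    by have /andP[_] := p_bounds t; nra.
  pose K := (f (m / 2) + C * cos (m / 2)) / sin (m / 2).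
  have lim : f t + C * cos t - K * sin t @[t --> 0^'+] --> 0 + C * cos 0 - K * sin 0.
    apply: cvgB; first apply: cvgD => //.
      apply: cvgM; first exact: cvg_cst.
      by apply: cvg_at_right_filter; exact: continuous_cos.
    apply: cvgM; first exact: cvg_cst.
    by apply: cvg_at_right_filter; exact: continuous_sin.
  rewrite cos0 sin0 in lim.
  near (0 : R)^'+ => t.
  have : f t + C * cos t - K * sin t < 0.
    by near: t; apply: (cvgr_lt (F := 0^'+) _ lim); lra.
  apply/negP; rewrite -leNgt subr_ge0.
  have t0 : 0 < t by near: t; exact: nbhs_right_gt.
  have tm : t < m / 2 by near: t; apply: nbhs_right_lt; rewrite /m; lra.
  rewrite -ler_pdivlMr; last first.
    by apply: sin_gt0_pi; rewrite /m in tm; apply/andP; split; lra.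
  rewrite -lerN2.
  apply: (@is_derive_ndecr _ (fun s => - ((f s + C * cos s) / sin s))
    (fun s => - ((w s - C) / sin s ^+ 2)) 0 m); rewrite /m in tm wC *; try lra.
    move=> s /andP[s0 sm]; apply: is_deriveN; apply: dq.
    by apply/andP; split; lra.
  move=> s sm; rewrite -mulNr mulr_ge0 ?invr_ge0 ?exprn_even_ge0 //.
  by have := wC s sm; lra.
(* p w > 0 at pi / 2: the contradiction is obtained at the endpoint pi. *)
- pose m : R := pi / 2.
  pose C := p m * w m / expR a.
  have C0 : 0 < C by rewrite divr_gt0.
  have wC t : m < t < pi -> C <= w t.
    move=> /andP[mt tpi]; rewrite ler_pdivrMr //.
    have pw : p m * w m < p t * w t by apply: pw_incr => //; rewrite /m; lra.
    have wt0 : 0 < w t by rewrite -(pmulr_rgt0 _ (p0 t)); rewrite /m in pw; lra.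
    by have /andP[_] := p_bounds t; nra.
  pose n : R := (m + pi) / 2.
  pose K := (f n + C * cos n) / sin n.
  have lim : f t + C * cos t - K * sin t @[t --> pi^'-] --> 0 + C * cos pi - K * sin pi.
    apply: cvgB; first apply: cvgD => //.
      apply: cvgM; first exact: cvg_cst.
      by apply: cvg_at_left_filter; exact: continuous_cos.
    apply: cvgM; first exact: cvg_cst.
    by apply: cvg_at_left_filter; exact: continuous_sin.
  rewrite cospi sinpi in lim.
  near (pi : R)^'- => t.
  have : f t + C * cos t - K * sin t < 0.
    by near: t; apply: (cvgr_lt (F := pi^'-) _ lim); lra.
  apply/negP; rewrite -leNgt subr_ge0.
  have tpi : t < pi by near: t; exact: nbhs_left_lt.
  have nt : n < t by near: t; apply: nbhs_left_gt; rewrite /n /m; lra.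
  rewrite -ler_pdivlMr; last first.
    by apply: sin_gt0_pi; rewrite /n /m in nt; apply/andP; split; lra.
  apply: (@is_derive_ndecr _ (fun s => (f s + C * cos s) / sin s)
    (fun s => (w s - C) / sin s ^+ 2) m pi); rewrite /n /m in nt wC *; try lra.
    by move=> s /andP[ms spi]; apply: dq; apply/andP; split; lra.
  move=> s sm; rewrite mulr_ge0 ?invr_ge0 ?exprn_even_ge0 //.
  by have := wC s sm; lra.
Unshelve. all: by end_near. Qed.

(** [sin_eigenfunction] shows that a principal eigenvalue exists; the bound then
holds for whichever one [xget] returns. *)
Lemma principal_eigenvalue_ge eps : 0 < eps ->
  ((1 + eps)%:E <= principal_eigenvalue
     (regularized eps (transport sin_speed sin_potential)) (segment pi))%E.
Proof.
move=> eps0; rewrite /principal_eigenvalue.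
have ex := sin_eigenfunction eps.
case: xgetP => [_ _ [mu [psi [C2psi cpsi psi0 psib eqn]] <-]|/(_ (1 + eps)%:E)];
  last first.
  by case; exists (1 + eps).
rewrite lee_fin.
have inL t : 0 < t < pi -> segment pi (pt t) by rewrite /segment /= coord_pt.
have pi0 : (0 : R) < pi := pi_gt0 R.
pose dpsi := 'D_(delta_mx 0 0) psi.
have C1dpsi : class_C 1 (segment pi) dpsi by case: C2psi => _ /(_ 0)[].
have psi_cvg (F : set_system R) (FF : Filter F) (l : R) : (l = 0 \/ l = pi) ->
    F --> l -> (\forall t \near F, 0 < t < pi) -> psi (pt t) @[t --> F] --> (0 : R).
  move=> lb Fl Fin.
  have bl : boundary (segment pi) (pt l) by rewrite boundary_segment //= coord_pt.
  have cl : closure (segment pi) (pt l) by case: bl.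
  have lim : psi x @[x --> within (closure (segment pi)) (nbhs (pt l))] --> (0 : R).
    by rewrite -(psib _ bl); exact: (subspace_continuousP _ _).1 cpsi _ cl.
  move=> P /lim; rewrite /= /within /= => /near_pt.
  rewrite coord_pt => /Fl /= FP; rewrite /= /nbhs /=.
  near=> t; apply: (near FP t) => //; apply: subset_closure; apply: inL.
  by near: t.
apply: (sturm_lower_bound eps0 (f := psi \o pt) (df := dpsi \o pt)
  (ddf := 'D_(delta_mx 0 0) dpsi \o pt)).
- by move=> t /inL Lt; have := class_C_is_derive C2psi Lt; rewrite coord_pt.
- by move=> t /inL Lt; have := class_C_is_derive C1dpsi Lt; rewrite coord_pt.
- by move=> t /inL /psi0.
- apply: (psi_cvg _ _ 0); [by left | exact: cvg_at_right_filter |].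
  near=> t; apply/andP; split; near: t; first exact: nbhs_right_gt.
  exact: nbhs_right_lt.
- apply: (psi_cvg _ _ pi); [by right | exact: cvg_at_left_filter |].
  near=> t; apply/andP; split; near: t; first exact: nbhs_left_gt.
  exact: nbhs_left_lt.
- move=> t /inL Lt; have := eqn _ Lt.
  by rewrite regularized_transportE !mxE.
Unshelve. all: by end_near. Qed.

Lemma sin_transport_lambda_star :
  (0 < lambda_star (transport sin_speed sin_potential) (segment (pi : R)))%E.
Proof.
apply: (@lt_le_trans _ _ 1%E); first by rewrite lte_fin.
rewrite /lambda_star limf_einfE; apply: le_ereal_sup_tmp.
eexists; first by exists [set eps : R | 0 < eps] => //; exact: nbhs_right_gt.
apply/ereal_infP => _ [eps eps0 <-].
by apply: le_trans (principal_eigenvalue_ge eps0); rewrite lee_fin lerDl ltW.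
Qed.
End SineTransport.

(** * The counterexamples *)

Theorem proposition2p1 (R : realType) :
  (exists (N : nat) (Om O : set 'rV[R]_N)
      (A : 'rV[R]_N -> 'M[R]_N) (b : 'rV[R]_N -> 'rV[R]_N) (c : 'rV[R]_N -> R),
    [/\ (1 <= N)%N, admissible Om O A b c, ~ MP (linear_op A b c) Om,
        (0 < lambda1 (linear_op A b c) Om)%E
      & structure_condition (linear_op A b c) O]) /\
  (exists (N : nat) (Om O : set 'rV[R]_N)
      (A : 'rV[R]_N -> 'M[R]_N) (b : 'rV[R]_N -> 'rV[R]_N) (c : 'rV[R]_N -> R),
    [/\ (1 <= N)%N, admissible Om O A b c, ~ MP (linear_op A b c) Om,
        (0 < lambda_star (linear_op A b c) Om)%E
      & structure_condition (linear_op A b c) O]) /\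
  (exists (N : nat) (Om O : set 'rV[R]_N)
      (A : 'rV[R]_N -> 'M[R]_N) (b : 'rV[R]_N -> 'rV[R]_N) (c : 'rV[R]_N -> R),
    [/\ (1 <= N)%N, admissible Om O A b c, ~ MP (linear_op A b c) Om
      & (0 < lambda1_bar (linear_op A b c) Om)%E]).
Proof.
split; [|split].
- exists 1%N, (segment pi), setT, (fun=> 0), (fun x => pt (- sin_speed (x 0 0))),
    (fun x => sin_potential (x 0 0)); split => //.
  + exact: sin_transport_admissible.
  + exact: sin_transport_not_MP.
  + exact: sin_transport_lambda1.
  + exact: sin_transport_structure.
- exists 1%N, (segment pi), setT, (fun=> 0), (fun x => pt (- sin_speed (x 0 0))),
    (fun x => sin_potential (x 0 0)); split => //.
  + exact: sin_transport_admissible.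
  + exact: sin_transport_not_MP.
  + exact: sin_transport_lambda_star.
  + exact: sin_transport_structure.
- exists 1%N, (segment 1), setT, (fun=> 0), (fun x => pt (- root_speed (x 0 0))),
    (fun=> 4^-1); split => //.
  + exact: root_transport_admissible.
  + exact: root_transport_not_MP.
  + exact: root_transport_lambda1_bar.
Qed.
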